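(* For any $\mathbf p,\mathbf q\in\Delta_n$ and any $K,\tilde K\in\mathbb{R}^{n\times n}$ with strictly positive entries, $$\|\Pi^{\mathcal S}(K)-\Pi^{\mathcal S}(\tilde K)\|_1\le\|\log K-\log\tilde K\|_\infty .$$
   Context: $\Delta_n=\{v\in\mathbb{R}^n_{\ge0}:\sum_iv_i=1\}$. $\mathcal M(\mathbf p,\mathbf q)=\{P\in\mathbb{R}_{\ge0}^{n\times n}:P\mathbf 1=\mathbf p,\ P^\top\mathbf 1=\mathbf q\}$, $\mathbf 1$ the all-ones vector. The Sinkhorn projection $\Pi^{\mathcal S}(K)=\Pi^{\mathcal S}_{\mathcal M(\mathbf p,\mathbf q)}(K)$ is the unique matrix in $\mathcal M(\mathbf p,\mathbf q)$ of the form $D_1KD_2$ with $D_1,D_2$ positive diagonal; by a classical result (Wilson 1969) it equals $\arg\min_{P\in\mathcal M(\mathbf p,\mathbf q)}\langle-\log K,P\rangle-H(P)$, which is taken as the definition when $\mathbf p$ or $\mathbf q$ has zero entries. Here $H(P)=\sum_{ij}P_{ij}\log\frac1{P_{ij}}$ (with $0\log\frac10=0$). Logarithms of matrices are entrywise; $\|A\|_1=\sum_{ij}|A_{ij}|$ and $\|A\|_\infty=\max_{ij}|A_{ij}|$. *)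

(* Defs.v *)
From mathcomp Require Import all_boot all_order all_algebra.
From mathcomp Require Import all_classical all_reals all_analysis.

Set Implicit Arguments.
Unset Strict Implicit.
Unset Printing Implicit Defensive.

Import Order.TTheory GRing.Theory Num.Theory.
Import numFieldNormedType.Exports.

Local Open Scope classical_set_scope.
Local Open Scope ring_scope.

Definition simplex (R : realType) (n : nat) : set 'cV[R]_n :=
  [set v : 'cV[R]_n | (forall i, 0 <= v i 0) /\ \sum_i v i 0 = 1].

Definition transport_polytope (R : realType) (n : nat) (p q : 'cV[R]_n) :
    set 'M[R]_n :=
  [set P : 'M[R]_n | [/\ forall i j, 0 <= P i j,
               P *m const_mx 1 = p
             & P^T *m const_mx 1 = q]].

Definition log_mx (R : realType) (n : nat) (K : 'M[R]_n) : 'M[R]_n :=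
  map_mx (@ln R) K.

Definition frobenius_dot (R : realType) (n : nat) (A B : 'M[R]_n) : R :=
  \sum_i \sum_j A i j * B i j.

(* Since 0^-1 = 0 in a field, a zero entry contributes 0 * ln 0 = 0. *)
Definition mx_entropy (R : realType) (n : nat) (P : 'M[R]_n) : R :=
  \sum_i \sum_j P i j * ln (P i j)^-1.

Definition mx_norm1 (R : realType) (n : nat) (A : 'M[R]_n) : R :=
  \sum_i \sum_j `|A i j|.

Definition argmin_set (R : realType) (T : Type) (A : set T) (f : T -> R) :
    set T :=
  [set x | A x /\ forall y, A y -> f x <= f y].

Definition positive_scaling (R : realType) (n : nat) (K : 'M[R]_n) :
    set 'M[R]_n :=
  [set P : 'M[R]_n | exists d1 d2 : 'rV[R]_n,
    [/\ forall i, 0 < d1 0 i, forall j, 0 < d2 0 j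
      & P = diag_mx d1 *m K *m diag_mx d2]].

Definition sinkhorn_set (R : realType) (n : nat) (p q : 'cV[R]_n)
    (K : 'M[R]_n) : set 'M[R]_n :=
  if [forall i, (0 < p i 0) && (0 < q i 0)]
  then transport_polytope p q `&` positive_scaling K
  else argmin_set (transport_polytope p q)
         (fun P => frobenius_dot (- log_mx K) P - mx_entropy P).

(* For p, q in the simplex and K entrywise positive, sinkhorn_set p q K is a
   singleton; outside that range the default value 0 may be returned. *)
Definition sinkhorn (R : realType) (n : nat) (p q : 'cV[R]_n) (K : 'M[R]_n) :
    'M[R]_n :=
  xget 0 (sinkhorn_set p q K).

(* Main.v *)
Require Import Defs.
From mathcomp Require Import all_boot all_order all_algebra.
From mathcomp Require Import all_classical all_reals all_analysis.
From mathcomp Require Import ring lra.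

(* Write E_h(P) = sum P (ln P - h) for the objective with h = log K. By Pinsker's
   inequality the entropy is 1-strongly convex for the l1 norm, so that for
   P = sinkhorn K and every coupling Q,
     E_h(Q) - E_h(P) >= ||P - Q||_1^2 / 2.
   When P is given in scaling form this holds because the difference is then
   exactly the divergence KL(Q || P). Adding this bound to the one for K' with P
   and P' exchanged, the entropies cancel and
     ||P - P'||_1^2 <= <log K - log K', P - P'>
                    <= ||log K - log K'||_oo ||P - P'||_1.
   The minimizer exists by compactness of the polytope. If the marginals are
   positive then it is positive, since x ln x has slope -oo at 0, and
   stationarity along marginal-preserving directions puts it in scaling form. *)

Set Implicit Arguments.
Unset Strict Implicit.
Unset Printing Implicit Defensive.

Import Order.TTheory GRing.Theory Num.Theory.
Import numFieldNormedType.Exports.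

Local Open Scope classical_set_scope.
Local Open Scope ring_scope.

(** * Bounds on the logarithm *)

Lemma lnV_total (R : realType) (x : R) : ln x^-1 = - ln x.
Proof.
have [x0|x0] := ltP 0 x; first by rewrite lnV.
by rewrite !ln0 ?invr_le0 ?oppr0.
Qed.

Lemma le_ln_sub1 (R : realType) (x : R) : 0 < x -> ln x <= x - 1.
Proof.
by move=> x0; have := @le_ln1Dx R (x - 1); rewrite subrKC; apply; lra.
Qed.

(* Partial fractions of [(u - 1) * (5 * u + 1) / (2 * u * (u + 2))]. *)
Definition ln_minorant (R : realType) (u : R) : R :=
  (5 / 2) - (1 / 4) * u^-1 - (27 / 4) * (u + 2)^-1.

Lemma is_derive_ln_sub_minorant (R : realType) (u : R) : 0 < u ->
  is_derive u 1 (fun v : R => ln v - ln_minorant v)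
    ((u - 1) ^+ 3 / (u ^+ 2 * (u + 2) ^+ 2)).
Proof.
move=> u0.
have u2 : u + 2 != 0 by apply: lt0r_neq0; lra.
have un0 : u != 0 by apply: lt0r_neq0.
have dln := is_derive1_ln u0.
have di : is_derive u 1 (fun v : R => v^-1) (- u ^- 2 *: 1).
  by apply: is_deriveV.
have dj : is_derive u 1 (fun v : R => (v + 2)^-1) (- (u + 2) ^- 2 *: (1 + 0)).
  by apply: is_deriveV.
rewrite /ln_minorant.
apply: is_derive_eq.
rewrite /GRing.scale /=.
by field; rewrite un0 u2.
Qed.

(** [ln_minorant] agrees with [ln] to third order at 1, so the derivative of the difference has the
    sign of [(u - 1) ^+ 3]. The mean value theorem between [u] and 1, where the difference vanishes,
    gives the bound on either side. *)
Lemma ln_minorant_le (R : realType) (u : R) : 0 < u -> ln_minorant u <= ln u.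
Proof.
move=> u0; rewrite -subr_ge0.
have d1 : ln 1 - ln_minorant (1 : R) = 0.
  by rewrite ln1 /ln_minorant; field; lra.
pose df (v : R) := (v - 1) ^+ 3 / (v ^+ 2 * (v + 2) ^+ 2).
have cont a b : 0 < a ->
    {within `[a, b], continuous (fun v : R => ln v - ln_minorant v)}.
  move=> a0; apply: derivable_within_continuous => x; rewrite in_itv/= => /andP[ax _].
  have := is_derive_ln_sub_minorant (lt_le_trans a0 ax).
  by move=> ?; apply: ex_derive.
have den (v : R) : 0 <= (v ^+ 2 * (v + 2) ^+ 2)^-1.
  by rewrite invr_ge0 mulr_ge0 ?sqr_ge0.
have [u1|u1|->] := ltgtP u 1; last by rewrite d1.
- have [c|c] := @MVT R (fun v : R => ln v - ln_minorant v) df u 1 u1 _ (cont _ _ u0).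
    rewrite in_itv/= => /andP[uc _]; apply: is_derive_ln_sub_minorant; lra.
  rewrite in_itv/= => /andP[uc c1]; rewrite d1 /df => E.
  rewrite -oppr_le0 -sub0r E mulrAC mulr_le0_ge0//.
  have -> : (c - 1) ^+ 3 * (1 - u) = - ((1 - c) ^+ 3 * (1 - u)) by ring.
  by rewrite oppr_le0 mulr_ge0// ?exprn_ge0//; lra.
- have [c|c] := @MVT R (fun v : R => ln v - ln_minorant v) df 1 u u1 _ (cont _ _ ltr01).
    rewrite in_itv/= => /andP[uc _]; apply: is_derive_ln_sub_minorant; lra.
  rewrite in_itv/= => /andP[uc c1]; rewrite d1 subr0 => ->.
  by rewrite /df !mulr_ge0// ?exprn_ge0//; lra.
Qed.

(* Combines [3 / 2 * (x - y) ^+ 2 / (x + 2 * y) <= x * ln (x / y) - x + y] with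
   AM-GM; a choice of [t] after summation replaces Cauchy-Schwarz. *)
Lemma pinsker_pointwise (R : realType) (x y t : R) :
  0 <= x -> 0 <= y -> (y = 0 -> x = 0) ->
  3 * t * `|x - y| - 3 / 2 * t ^+ 2 * (x + 2 * y)
    <= x * (ln x - ln y) - x + y.
Proof.
move=> x0 y0 ac.
have [y_eq0|yn0] := eqVneq y 0.
  by rewrite y_eq0 (ac y_eq0) subrr normr0; lra.
have yp : 0 < y by rewrite lt_neqAle eq_sym yn0.
have [->|xn0] := eqVneq x 0.
  rewrite sub0r normrN ger0_norm //.
  (* At [x = 0] the gap is [y * (3 * (t - 1 / 2) ^+ 2 + 1 / 4)]. *)
  have := mulr_ge0 y0 (sqr_ge0 (t - 1 / 2)); nra.
have xp : 0 < x by rewrite lt_neqAle eq_sym xn0.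
have wp : 0 < x + 2 * y by lra.
set d := `|x - y|.
have dE : d ^+ 2 = (x - y) ^+ 2 by rewrite /d real_normK ?num_real.
apply: (@le_trans _ _ (3 / 2 * (d ^+ 2 / (x + 2 * y)))).
  rewrite -subr_ge0.
  have -> : 3 / 2 * (d ^+ 2 / (x + 2 * y)) -
      (3 * t * d - 3 / 2 * t ^+ 2 * (x + 2 * y))
      = 3 / 2 * ((d - t * (x + 2 * y)) ^+ 2 / (x + 2 * y)).
    by field; rewrite lt0r_neq0.
  by rewrite mulr_ge0 ?divr_ge0 ?sqr_ge0 // ?ltW //; lra.
rewrite dE -ln_div ?posrE //.
have := ler_wpM2l x0 (ln_minorant_le (divr_gt0 xp yp)).
(* The shape of [ln_minorant] is dictated by this identity. *)
have -> : x * ln_minorant (x / y) = 3 / 2 * ((x - y) ^+ 2 / (x + 2 * y)) + x - y.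
  by rewrite /ln_minorant; field; rewrite xn0 yn0 lt0r_neq0.
lra.
Qed.

(** * Pinsker's inequality and strong convexity *)

Definition distribution (R : realType) (I : finType) (P : I -> R) : Prop :=
  (forall i, 0 <= P i) /\ \sum_i P i = 1.

(** The functional [E_h]; the general index type allows a matrix to be treated as one vector indexed
    by pairs. *)
Definition free_energy (R : realType) (I : finType) (h P : I -> R) : R :=
  \sum_i (P i * ln (P i) - P i * h i).

Lemma pinsker (R : realType) (I : finType) (P Q : I -> R) :
  distribution P -> distribution Q -> (forall i, Q i = 0 -> P i = 0) ->
  (\sum_i `|P i - Q i|) ^+ 2 / 2 <= \sum_i P i * (ln (P i) - ln (Q i)).
Proof.
move=> [P0 P1] [Q0 Q1] ac.
set S := \sum_i `|P i - Q i|.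
(* The weights [P i + 2 * Q i] sum to 3, so the summed lower bound is [3 * t * S - 9 / 2 * t ^+ 2].
   It is largest at [t = S / 3], with value [S ^+ 2 / 2]. *)
have : \sum_i (3 * (S / 3) * `|P i - Q i| - 3 / 2 * (S / 3) ^+ 2 * (P i + 2 * Q i))
    <= \sum_i (P i * (ln (P i) - ln (Q i)) - P i + Q i).
  by apply: ler_sum => i _; apply: pinsker_pointwise; auto.
rewrite !big_split /= !sumrN -!mulr_sumr big_split /= -mulr_sumr P1 Q1 -/S.
lra.
Qed.

(** The convexity defect at the mixture [M] is exactly [(1 - t) KL(P || M) + t KL(Q || M)]. The l1
    distances to [M] are [t * S] and [(1 - t) * S], so Pinsker's inequality applies to each
    divergence. *)
Lemma free_energy_convex (R : realType) (I : finType) (h P Q : I -> R) (t : R) :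
  distribution P -> distribution Q -> 0 < t < 1 ->
  free_energy h (fun i => (1 - t) * P i + t * Q i)
    + t * (1 - t) * ((\sum_i `|P i - Q i|) ^+ 2 / 2)
  <= (1 - t) * free_energy h P + t * free_energy h Q.
Proof.
move=> dP dQ /andP[t0 t1].
have [P0 P1] := dP; have [Q0 Q1] := dQ.
set M := fun i => (1 - t) * P i + t * Q i.
have s0 : 0 < 1 - t by lra.
have dM : distribution M.
  split=> [i|]; first by rewrite addr_ge0 // mulr_ge0 // ltW.
  by rewrite big_split /= -!mulr_sumr P1 Q1; lra.
have PM i : M i = 0 -> P i = 0.
  by move=> Mi; have := P0 i; have := Q0 i; move: Mi; rewrite /M; nra.
have QM i : M i = 0 -> Q i = 0.
  by move=> Mi; have := P0 i; have := Q0 i; move: Mi; rewrite /M; nra.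
set S := \sum_i `|P i - Q i|.
have SP : \sum_i `|P i - M i| = t * S.
  rewrite mulr_sumr; apply: eq_bigr => i _.
  by rewrite -[t in RHS]gtr0_norm // -normrM /M; congr (`|_|); ring.
have SQ : \sum_i `|Q i - M i| = (1 - t) * S.
  rewrite mulr_sumr; apply: eq_bigr => i _.
  by rewrite -[1 - t in RHS]gtr0_norm // -normrM distrC /M; congr (`|_|); ring.
have := pinsker dP dM PM; rewrite SP => kP.
have := pinsker dQ dM QM; rewrite SQ => kQ.
have -> : (1 - t) * free_energy h P + t * free_energy h Q
    = free_energy h M
      + ((1 - t) * (\sum_i P i * (ln (P i) - ln (M i)))
         + t * (\sum_i Q i * (ln (Q i) - ln (M i)))).
  rewrite /free_energy !mulr_sumr -!big_split /=; apply: eq_bigr => i _.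
  by rewrite /M; ring.
have := ler_wpM2l (ltW s0) kP; have := ler_wpM2l (ltW t0) kQ.
rewrite lerD2l; move=> a b; apply: le_trans (lerD b a).
by rewrite le_eqVlt; apply/orP; left; apply/eqP; field.
Qed.

(** * Energy gaps and stability *)

Lemma ler_linear_slope (R : realType) (a b : R) :
  (forall t, 0 < t < 1 -> (1 - t) * a <= b) -> a <= b.
Proof.
move=> H; rewrite leNgt; apply/negP => ab.
have H2 : (1 - 1 / 2) * a <= b by apply: H; apply/andP; split; lra.
have a0 : 0 < a by move: H2 ab; lra.
(* At this [t] the hypothesis bounds the midpoint of [a] and [b] by [b], against [b < a]. *)
have {H} := H ((a - b) / (2 * a)).
have -> : (1 - (a - b) / (2 * a)) * a = (a + b) / 2.
  by field; rewrite lt0r_neq0.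
have -> : 0 < (a - b) / (2 * a) < 1.
  by rewrite divr_gt0 ?ltr_pdivrMr; lra.
by move=> /(_ isT); lra.
Qed.

(** Minimality of [P] against the mixture with [Q], combined with strong convexity and divided by
    [t], leaves a factor [1 - t] that [ler_linear_slope] removes. *)
Lemma minimizer_energy_gap (R : realType) (I : finType) (A : set (I -> R))
    (h P Q : I -> R) :
  (forall P, A P -> distribution P) ->
  (forall P Q t, A P -> A Q -> 0 < t < 1 ->
    A (fun i => (1 - t) * P i + t * Q i)) ->
  A P -> (forall Q, A Q -> free_energy h P <= free_energy h Q) -> A Q ->
  (\sum_i `|P i - Q i|) ^+ 2 / 2 <= free_energy h Q - free_energy h P.
Proof.
move=> dA cA AP minP AQ; apply: ler_linear_slope => t t01.
have /andP[t0 t1] := t01.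
have convM := free_energy_convex h (dA _ AP) (dA _ AQ) t01.
have minM := minP _ (cA _ _ _ AP AQ t01).
rewrite -(ler_pM2l t0); move: minM convM; lra.
Qed.

(** Vanishing of the first-order term turns the energy difference into [KL(Q || P)]. This serves
    positive marginals, where [sinkhorn_set] prescribes a scaling form instead of minimality. *)
Lemma tilted_energy_gap (R : realType) (I : finType) (h P Q : I -> R) :
  distribution P -> distribution Q -> (forall i, 0 < P i) ->
  \sum_i (Q i - P i) * (ln (P i) - h i) = 0 ->
  (\sum_i `|P i - Q i|) ^+ 2 / 2 <= free_energy h Q - free_energy h P.
Proof.
move=> dP dQ P0 st.
have -> : \sum_i `|P i - Q i| = \sum_i `|Q i - P i|.
  by apply: eq_bigr => i _; rewrite distrC.
apply: le_trans (pinsker dQ dP _) _.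
  by move=> i Pi; have := P0 i; rewrite Pi ltxx.
rewrite le_eqVlt; apply/orP; left; apply/eqP.
rewrite -[LHS]addr0 -[X in _ + X]st /free_energy -sumrB -big_split /=.
by apply: eq_bigr => i _; ring.
Qed.

(* The entropies cancel in the sum of the two gaps, leaving the pairing of
   [h - h'] with [P - P']. *)
Lemma energy_gaps_le (R : realType) (I : finType) (h h' P P' : I -> R) (c : R) :
  0 <= c -> (forall i, `|h i - h' i| <= c) ->
  (\sum_i `|P i - P' i|) ^+ 2 / 2 <= free_energy h P' - free_energy h P ->
  (\sum_i `|P' i - P i|) ^+ 2 / 2 <= free_energy h' P - free_energy h' P' ->
  \sum_i `|P i - P' i| <= c.
Proof.
move=> c0 hc g g'.
have S' : \sum_i `|P' i - P i| = \sum_i `|P i - P' i|.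
  by apply: eq_bigr => i _; rewrite distrC.
move: g'; rewrite S' => g'.
set S := \sum_i `|P i - P' i| in g g' *.
have S0 : 0 <= S by apply: sumr_ge0.
have : S ^+ 2 <= c * S.
  have E : (free_energy h P' - free_energy h P) +
      (free_energy h' P - free_energy h' P') =
      \sum_i (h i - h' i) * (P i - P' i).
    by rewrite /free_energy -!sumrB -big_split /=; apply: eq_bigr => i _; ring.
  apply: (@le_trans _ _ (\sum_i (h i - h' i) * (P i - P' i))).
    by rewrite -E; lra.
  rewrite mulr_sumr; apply: ler_sum => i _.
  apply: le_trans (ler_norm _) _; rewrite normrM.
  by rewrite ler_wpM2r.
have [->//|Sn0] := eqVneq S 0.
by rewrite expr2 ler_pM2r // lt_neqAle eq_sym Sn0.
Qed.

(** * Positivity and stationarity of minimizers *)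

Lemma xlnx_convex (R : realType) (x y t : R) : 0 <= x -> 0 <= y -> 0 < t < 1 ->
  ((1 - t) * x + t * y) * ln ((1 - t) * x + t * y)
    <= (1 - t) * (x * ln x) + t * (y * ln y).
Proof.
move=> x0 y0 /andP[t0 t1].
set m := (1 - t) * x + t * y.
have s0 : 0 < 1 - t by lra.
have m0 : 0 <= m by rewrite addr_ge0 // mulr_ge0 // ltW.
have mx : m = 0 -> x = 0 by rewrite /m; nra.
have my : m = 0 -> y = 0 by rewrite /m; nra.
(* With parameter 0, [pinsker_pointwise] is the tangent-line inequality of [x ln x] at [m];
   averaging cancels the linear terms. *)
have := ler_wpM2l (ltW s0) (pinsker_pointwise 0 x0 m0 mx).
have := ler_wpM2l (ltW t0) (pinsker_pointwise 0 y0 m0 my).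
have -> : m * ln m = (1 - t) * (x * ln m) + t * (y * ln m) by rewrite /m; ring.
have : (1 - t) * (x - m) + t * (y - m) = 0 by rewrite /m; ring.
lra.
Qed.

Lemma minimizer_pos (R : realType) (I : finType) (A : set (I -> R))
    (h P Q : I -> R) (i : I) :
  (forall P, A P -> distribution P) ->
  (forall P Q t, A P -> A Q -> 0 < t < 1 ->
    A (fun i => (1 - t) * P i + t * Q i)) ->
  A P -> (forall Q, A Q -> free_energy h P <= free_energy h Q) -> A Q ->
  0 < Q i -> 0 < P i.
Proof.
move=> dA cA AP minP AQ Qi.
have [P0 _] := dA _ AP; have [Q0 _] := dA _ AQ.
rewrite lt_neqAle P0 andbT; apply/eqP => /esym Pi.
set B := free_energy h Q - free_energy h P.
have B0 : 0 <= B by rewrite subr_ge0; exact: minP.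
(* The slope of [x ln x] at [0] is infinite: for this small a step towards [Q],
   the [i]-th term alone decreases the energy by more than [t * B]. *)
set t := expR (- ((B + 1) / Q i)).
have t01 : 0 < t < 1.
  by rewrite expR_gt0 -expR0 ltr_expR oppr_lt0 divr_gt0 //; lra.
have /andP[t0 t1] := t01.
have lnt : Q i * ln t = - (B + 1) by rewrite expRK; field; rewrite lt0r_neq0.
have := minP _ (cA _ _ _ AP AQ t01).
(* Convexity bounds the other terms by interpolation; the [i]-th term is its interpolation plus
   [t * (Q i * ln t)], as [P i = 0]. *)
suff : free_energy h (fun i => (1 - t) * P i + t * Q i) <=
    (1 - t) * free_energy h P + t * free_energy h Q + t * (Q i * ln t).
  rewrite lnt => le1 le2.
  have : t * (B - (B + 1)) >= 0 by move: le1 le2; rewrite /B; lra.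
  by rewrite pmulr_rge0 //; lra.
have bigDi (F : I -> R) : \sum_j F j = F i + \sum_(j | j != i) F j.
  by rewrite (bigD1 i).
rewrite /free_energy !bigDi Pi mulr0 !mul0r subrr !add0r.
rewrite (@lnM R t (Q i)) ?posrE //.
have : \sum_(j | j != i) (((1 - t) * P j + t * Q j) * ln ((1 - t) * P j + t * Q j)
        - ((1 - t) * P j + t * Q j) * h j)
    <= (1 - t) * (\sum_(j | j != i) (P j * ln (P j) - P j * h j))
       + t * (\sum_(j | j != i) (Q j * ln (Q j) - Q j * h j)).
  rewrite !mulr_sumr -big_split /=; apply: ler_sum => j _.
  have := xlnx_convex (P0 j) (Q0 j) t01; lra.
lra.
Qed.

(** In place of differentiation, [ln x <= x - 1] gives a quadratic upper bound on the energy along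
    [D], with slope [c] at 0. A small step against the sign of [c] would go below the minimum. *)
Lemma minimizer_stationary (R : realType) (I : finType) (h P D : I -> R) :
  (forall i, 0 < P i) -> \sum_i D i = 0 ->
  (forall s, (forall i, 0 <= P i + s * D i) ->
    free_energy h P <= free_energy h (fun i => P i + s * D i)) ->
  \sum_i D i * (ln (P i) - h i) = 0.
Proof.
move=> P0 D0 minP; set c := \sum_i _.
have [//|cn0] := eqVneq c 0; exfalso.
set C := \sum_i D i ^+ 2 / P i.
have C0 : 0 <= C by apply: sumr_ge0 => i _; rewrite divr_ge0 ?sqr_ge0 // ltW.
pose B i := `|c * D i| / P i.
have B0 i : 0 <= B i by rewrite divr_ge0 // ltW.
(* For the step [- (c / N)], [N > C] makes the energy change negative and [N >= B i] keeps each
   entry nonnegative. *)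
pose N := C + 1 + \sum_i B i.
have SB0 : 0 <= \sum_i B i by apply: sumr_ge0.
have N0 : 0 < N by rewrite /N; lra.
have BN i : B i <= N.
  rewrite /N (bigD1 i) //= -[leLHS]add0r; apply: lerD; first by lra.
  by rewrite lerDl sumr_ge0.
pose s := - (c / N).
have Ms i : 0 <= P i + s * D i.
  have : `|c * D i| <= N * P i by have := BN i; rewrite /B ler_pdivrMr.
  rewrite ler_norml => /andP[_ cD].
  have -> : P i + s * D i = (N * P i - c * D i) / N.
    by rewrite /s; field; rewrite lt0r_neq0.
  by rewrite divr_ge0 ?subr_ge0 // ltW.
have := minP s Ms.
suff le1 : free_energy h (fun i => P i + s * D i) <=
    free_energy h P + s * c + s ^+ 2 * C.
  move=> le2.
  have : 0 <= s * c + s ^+ 2 * C by move: le1 le2; lra.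
  have -> : s * c + s ^+ 2 * C = - (c ^+ 2 * (N - C) / N ^+ 2).
    by rewrite /s; field; rewrite lt0r_neq0.
  rewrite oppr_ge0 leNgt => /negP; apply.
  rewrite divr_gt0 ?exprn_gt0 // mulr_gt0 ?exprn_even_gt0 //.
  by rewrite /N; lra.
(* This zero sum absorbs the term [s * D i] that the logarithm bound leaves in each summand. *)
have E0 : s * \sum_i D i = 0 by rewrite D0 mulr0.
rewrite -[leRHS]addr0 -[X in _ + X]E0 /free_energy /c /C !mulr_sumr -!big_split /=.
apply: ler_sum => i _; have := Ms i; set m := P i + s * D i => m0.
have mE : m = P i + s * D i by [].
have Pi := P0 i.
have : m * (ln m - ln (P i)) <= m * (m / P i - 1).
  have [->|mn0] := eqVneq m 0; first by rewrite !mul0r.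
  have mp : 0 < m by rewrite lt_neqAle eq_sym mn0.
  by rewrite ler_pM2l // -ln_div ?posrE // le_ln_sub1 // divr_gt0.
have -> : m * (m / P i - 1) = s ^+ 2 * (D i ^+ 2 / P i) + s * D i.
  by rewrite /m; field; rewrite lt0r_neq0.
have -> : m * ln m - m * h i =
  m * (ln m - ln (P i)) + (P i * ln (P i) - P i * h i + s * (D i * (ln (P i) - h i))).
  by rewrite mE; ring.
lra.
Qed.

(** * Continuity, compactness and existence of a minimizer *)

Lemma xlnx_continuous (R : realType) : continuous (fun x : R => x * ln x).
Proof.
move=> x; have [x0|x0|->] := ltgtP x 0.
- rewrite /continuous_at (@ln0 _ x) ?mulr0; last exact: ltW.
  have cst0 : (fun=> 0 : R) @ x --> (0 : R) by exact: cvg_cst.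
  apply: cvg_trans cst0.
  apply: near_eq_cvg; near=> y.
  by rewrite ln0 ?mulr0 //; apply/ltW; near: y; exact: lt_nbhsl.
- by apply: continuousM; [exact: cvg_id|exact: continuous_ln].
rewrite /continuous_at mul0r.
(* For [y > 0] this is [ln x <= x - 1] at the inverse of [Num.sqrt y]; for [y <= 0] the default
   value of [ln] is 0. *)
have small (y : R) : `|y| < 1 -> `|y * ln y| <= 2 * Num.sqrt `|y|.
  have [y0|y0 y1] := leP y 0.
    by rewrite ln0 // mulr0 normr0 mulr_ge0 // sqrtr_ge0.
  rewrite gtr0_norm // in y1 *.
  set r := Num.sqrt y.
  have r0 : 0 < r by rewrite sqrtr_gt0.
  have yE : y = r ^+ 2 by rewrite sqr_sqrtr // ltW.
  have lny : ln y <= 0 by rewrite ln_le0 // ltW.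
  rewrite ler0_norm ?mulr_ge0_le0 // 1?ltW //.
  have := @le_ln_sub1 _ r^-1; rewrite invr_gt0 lnV_total => /(_ r0).
  rewrite -(ler_pM2l (exprn_gt0 2 r0)) mulrBr.
  have -> : r ^+ 2 * r^-1 = r by field; rewrite lt0r_neq0.
  have := exprn_gt0 2 r0.
  rewrite yE lnXn // -mulr_natl; nra.
have sqrt0 : 2 * Num.sqrt `|y| @[y --> (0 : R)] --> (0 : R).
  have E : 2 * Num.sqrt `|0 : R| = 0 by rewrite normr0 sqrtr0 mulr0.
  rewrite -[X in _ --> X]E.
  apply: cvgMl_tmp; apply: continuous_cvg; first exact: sqrt_continuous.
  exact: norm_continuous.
apply/norm_cvg0P; apply: (@squeeze_cvgr _ _ _ _ (cst 0)) sqrt0; last exact: cvg_cst.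
near=> y; rewrite normr_ge0 /= small //; near: y; exact: nbhs0_lt.
Unshelve. all: by end_near. Qed.

Definition entries (R : realType) (n : nat) (P : 'M[R]_n) (ij : 'I_n * 'I_n) : R :=
  P ij.1 ij.2.

Lemma transport_polytopeE (R : realType) (n : nat) (p q : 'cV[R]_n) (P : 'M[R]_n) :
  transport_polytope p q P <->
  [/\ forall i j, 0 <= P i j, forall i, \sum_j P i j = p i 0
    & forall j, \sum_i P i j = q j 0].
Proof.
have rowE i : (P *m const_mx 1 : 'cV[R]_n) i 0 = \sum_j P i j.
  by rewrite mxE; apply: eq_bigr => j _; rewrite mxE mulr1.
have colE j : (P^T *m const_mx 1 : 'cV[R]_n) j 0 = \sum_i P i j.
  by rewrite mxE; apply: eq_bigr => i _; rewrite !mxE mulr1.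
split=> [[P0 <- <-]|[P0 Pp Pq]]; first by split=> // k; rewrite ?rowE ?colE.
by split=> //; apply/matrixP => k l; rewrite ord1 ?rowE ?colE.
Qed.

Lemma transport_distribution (R : realType) (n : nat) (p q : 'cV[R]_n)
    (P : 'M[R]_n) :
  simplex p -> transport_polytope p q P ->
  distribution (entries P).
Proof.
move=> [_ p1] /transport_polytopeE [P0 Pp _]; split=> [ij|]; first exact: P0.
rewrite -(pair_bigA _ (fun i j => P i j)) /= -p1.
by apply: eq_bigr => i _.
Qed.

Lemma transport_convex (R : realType) (n : nat) (p q : 'cV[R]_n)
    (P Q : 'M[R]_n) (t : R) :
  transport_polytope p q P -> transport_polytope p q Q -> 0 < t < 1 ->
  transport_polytope p q ((1 - t) *: P + t *: Q).
Proof.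
move=> /transport_polytopeE [P0 Pp Pq] /transport_polytopeE [Q0 Qp Qq].
move=> /andP[t0 t1]; apply/transport_polytopeE; split=> [i j|i|j].
- by rewrite !mxE addr_ge0 // mulr_ge0 //; lra.
- under eq_bigr do rewrite !mxE.
  by rewrite big_split /= -!mulr_sumr Pp Qp; ring.
- under eq_bigr do rewrite !mxE.
  by rewrite big_split /= -!mulr_sumr Pq Qq; ring.
Qed.

(** Used twice: it makes the polytope nonempty, and for positive marginals it is the positive
    competitor for [minimizer_pos]. *)
Lemma product_coupling (R : realType) (n : nat) (p q : 'cV[R]_n) :
  simplex p -> simplex q -> transport_polytope p q (p *m q^T).
Proof.
move=> [p0 p1] [q0 q1].
have pqE i j : (p *m q^T) i j = p i 0 * q j 0 by rewrite !mxE big_ord1 !mxE.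
apply/transport_polytopeE; split=> [i j|i|j]; first by rewrite pqE mulr_ge0.
- by under eq_bigr do rewrite pqE; rewrite -mulr_sumr q1 mulr1.
- by under eq_bigr do rewrite pqE; rewrite -mulr_suml p1 mul1r.
Qed.

Lemma sinkhorn_objectiveE (R : realType) (n : nat) (K P : 'M[R]_n) :
  frobenius_dot (- log_mx K) P - mx_entropy P
    = free_energy (entries (log_mx K)) (entries P).
Proof.
rewrite /frobenius_dot /mx_entropy !pair_bigA /= -sumrB.
by apply: eq_bigr => -[i j] _; rewrite /entries /= lnV_total !mxE; ring.
Qed.

Lemma sum_continuous (R : realType) (T : topologicalType) (I : finType)
    (F : I -> T -> R) :
  (forall i, continuous (F i)) -> continuous (fun x => \sum_i F i x).
Proof. by move=> cF x; apply: cvg_big => [|i _]; [exact: add_continuous|exact: cF]. Qed.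

(** Matrices are flattened to row vectors to suit [EVT_min_rV]. Entries of a distribution are at
    most 1, and the constraints are closed conditions on continuous functions. *)
Lemma transport_compact (R : realType) (n : nat) (p q : 'cV[R]_n) :
  simplex p ->
  compact [set v : 'rV[R]_(n * n) | transport_polytope p q (vec_mx v)].
Proof.
move=> hp; apply: bounded_closed_compact.
  exists 1; split=> [|x x1 v hv]; first exact: num_real.
  apply: le_trans (ltW x1); rewrite [leLHS]/Num.Def.normr /= mx_normrE.
  apply: bigmax_le => // -[i k] _ /=; rewrite ord1 {i}.
  have [P0 P1] := transport_distribution hp hv.
  case/mxvec_indexP: k => i j.
  have vE : v 0 (mxvec_index i j) = entries (vec_mx v) (i, j).
    by rewrite /entries mxE.
  rewrite vE ger0_norm // -P1 (bigD1 (i, j)) //= lerDl.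
  by apply: sumr_ge0 => ij _; exact: P0.
have coord k : continuous (fun v : 'rV[R]_(n * n) => v 0 k).
  exact: coord_continuous.
have -> : [set v : 'rV[R]_(n * n) | transport_polytope p q (vec_mx v)] =
    \bigcap_ij ((fun v => v 0 (mxvec_index ij.1 ij.2)) @^-1` [set x : R | 0 <= x])
    `&` (\bigcap_i ((fun v => \sum_j v 0 (mxvec_index i j)) @^-1` [set x | x = p i 0])
    `&` \bigcap_j ((fun v => \sum_i v 0 (mxvec_index i j)) @^-1` [set x | x = q j 0])).
  apply/seteqP; split=> v /=.
    move=> /transport_polytopeE [v0 vp vq]; split; last split.
    - by move=> [i j] _ /=; have := v0 i j; rewrite mxE.
    - by move=> i _ /=; rewrite -(vp i); apply: eq_bigr => j _; rewrite mxE.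
    - by move=> j _ /=; rewrite -(vq j); apply: eq_bigr => i _; rewrite mxE.
  move=> [v0 [vp vq]]; apply/transport_polytopeE; split=> [i j|i|j].
  - by rewrite mxE; exact: (v0 (i, j)).
  - by rewrite -(vp i) //; apply: eq_bigr => j _; rewrite mxE.
  - by rewrite -(vq j) //; apply: eq_bigr => i _; rewrite mxE.
apply: closedI; last apply: closedI.
- apply: closed_bigI => ij _; apply: preimage_closed => [v _|]; first exact: coord.
  exact: closed_ge.
- apply: closed_bigI => i _; apply: preimage_closed => [v _|]; last exact: closed_eq.
  by apply: sum_continuous => j; exact: coord.
- apply: closed_bigI => j _; apply: preimage_closed => [v _|]; last exact: closed_eq.
  by apply: sum_continuous => i; exact: coord.
Qed.

Lemma sinkhorn_objective_argmin (R : realType) (n : nat) (p q : 'cV[R]_n)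
    (K : 'M[R]_n) :
  simplex p -> simplex q ->
  argmin_set (transport_polytope p q)
    (fun P => frobenius_dot (- log_mx K) P - mx_entropy P) !=set0.
Proof.
move=> hp hq.
pose f (v : 'rV[R]_(n * n)) :=
  frobenius_dot (- log_mx K) (vec_mx v) - mx_entropy (vec_mx v).
have cf : continuous f.
  pose g (ij : 'I_n * 'I_n) (v : 'rV[R]_(n * n)) : R :=
    let x := v 0 (mxvec_index ij.1 ij.2) in
    x * ln x - x * log_mx K ij.1 ij.2.
  have -> : f = fun v => \sum_ij g ij v.
    apply/funext => v; rewrite /f sinkhorn_objectiveE.
    by apply: eq_bigr => ij _; rewrite /entries mxE.
  apply: sum_continuous => ij v.
  have cv : {for v, continuous (fun v : 'rV[R]_(n * n) => v 0 (mxvec_index ij.1 ij.2))}.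
    exact: coord_continuous.
  apply: (@continuousB _ R^o _ (fun v : 'rV[R]_(n * n) =>
    v 0 (mxvec_index ij.1 ij.2) * ln (v 0 (mxvec_index ij.1 ij.2)))); last first.
    by apply: continuousM; [exact: cv|exact: cst_continuous].
  apply: (@continuous_comp _ _ _ _ (fun x : R => x * ln x)); first exact: cv.
  exact: xlnx_continuous.
have ne : [set v : 'rV[R]_(n * n) | transport_polytope p q (vec_mx v)] !=set0.
  by exists (mxvec (p *m q^T)); rewrite /= mxvecK; exact: product_coupling.
have [v] := EVT_min_rV ne (transport_compact hp) (continuous_subspaceT cf).
rewrite inE /= => hv minv; exists (vec_mx v); split=> // P hP.
by have := minv (mxvec P); rewrite inE /f /= mxvecK; exact.
Qed.

(** * Couplings as vectors, and the Sinkhorn scaling form *)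

Definition couplings (R : realType) (n : nat) (p q : 'cV[R]_n) :
    set ('I_n * 'I_n -> R) :=
  [set entries P | P in transport_polytope p q].

Lemma couplings_convex (R : realType) (n : nat) (p q : 'cV[R]_n)
    (P Q : 'I_n * 'I_n -> R) (t : R) :
  couplings p q P -> couplings p q Q -> 0 < t < 1 ->
  couplings p q (fun ij => (1 - t) * P ij + t * Q ij).
Proof.
move=> [P' hP <-] [Q' hQ <-] t01; exists ((1 - t) *: P' + t *: Q').
  exact: transport_convex.
by apply/funext => ij; rewrite /entries !mxE.
Qed.

Lemma couplings_distribution (R : realType) (n : nat) (p q : 'cV[R]_n)
    (P : 'I_n * 'I_n -> R) :
  simplex p -> couplings p q P -> distribution P.
Proof. by move=> hp [P' hP <-]; exact: transport_distribution hP. Qed.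

Lemma argmin_couplings (R : realType) (n : nat) (p q : 'cV[R]_n)
    (K P : 'M[R]_n) :
  argmin_set (transport_polytope p q)
    (fun P => frobenius_dot (- log_mx K) P - mx_entropy P) P ->
  forall Q, couplings p q Q ->
    free_energy (entries (log_mx K)) (entries P)
      <= free_energy (entries (log_mx K)) Q.
Proof.
by move=> [_ minP] _ [Q hQ <-]; rewrite -!sinkhorn_objectiveE; exact: minP.
Qed.

Lemma positive_scalingE (R : realType) (n : nat) (K P : 'M[R]_n) :
  positive_scaling K P <-> exists d1 d2 : 'I_n -> R,
    [/\ forall i, 0 < d1 i, forall j, 0 < d2 j
      & forall i j, P i j = d1 i * K i j * d2 j].
Proof.
split=> [[d1 [d2 [p1 p2 ->]]]|[d1 [d2 [p1 p2 PE]]]].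
  exists (d1 0), (d2 0); split=> // i j.
  by rewrite mul_mx_diag mul_diag_mx !mxE.
exists (\row_i d1 i), (\row_j d2 j); split=> [i|j|]; rewrite ?mxE //.
by apply/matrixP => i j; rewrite mul_mx_diag mul_diag_mx !mxE PE.
Qed.

Lemma sinkhorn_set_energy_gap (R : realType) (n : nat) (p q : 'cV[R]_n)
    (K P Q : 'M[R]_n) :
  simplex p -> (forall i j, 0 < K i j) -> sinkhorn_set p q K P ->
  transport_polytope p q Q ->
  (\sum_ij `|entries P ij - entries Q ij|) ^+ 2 / 2
    <= free_energy (entries (log_mx K)) (entries Q)
       - free_energy (entries (log_mx K)) (entries P).
Proof.
move=> hp K0; rewrite /sinkhorn_set; case: ifP => _; last first.
  move=> minP hQ; apply: (@minimizer_energy_gap R _ (couplings p q)).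
  - by move=> P' /couplings_distribution; exact.
  - by move=> *; exact: couplings_convex.
  - by exists P => //; exact: minP.1.
  - exact: argmin_couplings.
  - by exists Q.
move=> [hP /positive_scalingE [d1 [d2 [d10 d20 PE]]]] hQ.
have P0 i j : 0 < P i j by rewrite PE !mulr_gt0.
apply: tilted_energy_gap.
- exact: transport_distribution hP.
- exact: transport_distribution hQ.
- by move=> ij; exact: P0.
have /transport_polytopeE [_ Pp Pq] := hP.
have /transport_polytopeE [_ Qp Qq] := hQ.
(* In scaling form [ln P - log K] is a row function plus a column function; each pairs to 0 with
   [Q - P], whose row and column sums vanish. *)
transitivity (\sum_i \sum_j (Q i j - P i j) * ln (d1 i) +
              \sum_j \sum_i (Q i j - P i j) * ln (d2 j)).
  rewrite [X in _ = _ + X]exchange_big /= !pair_bigA -big_split /=.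
  apply: eq_bigr => -[i j] _; rewrite /entries /= mxE PE.
  by rewrite !lnM ?posrE ?mulr_gt0 //; ring.
rewrite !big1 ?addr0 // => [j _|i _].
  by rewrite -mulr_suml sumrB Pq Qq subrr mul0r.
by rewrite -mulr_suml sumrB Pp Qp subrr mul0r.
Qed.

Lemma sinkhorn_set_nonempty (R : realType) (n : nat) (p q : 'cV[R]_n)
    (K : 'M[R]_n) :
  simplex p -> simplex q -> (forall i j, 0 < K i j) ->
  sinkhorn_set p q K !=set0.
Proof.
move=> hp hq K0; have [P minP] := sinkhorn_objective_argmin K hp hq.
exists P; rewrite /sinkhorn_set; case: ifP => // /forallP pq0.
have hP := minP.1; split=> //.
have minE := argmin_couplings minP.
have P0 i j : 0 < P i j.
  have [Q hQ Q0] : exists2 Q, couplings p q Q & 0 < Q (i, j).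
    exists (entries (p *m q^T)).
      by exists (p *m q^T) => //; exact: product_coupling.
    have /andP[pi _] := pq0 i; have /andP[_ qj] := pq0 j.
    by rewrite /entries !mxE big_ord1 !mxE mulr_gt0.
  apply: (@minimizer_pos R _ (couplings p q) _ (entries P) Q (i, j)) minE hQ Q0.
  - by move=> P' /couplings_distribution; exact.
  - by move=> *; exact: couplings_convex.
  - by exists P.
(* The case [n = 0] is excluded because an empty sum is not 1. *)
have [i0 _] : exists i0 : 'I_n, True.
  case: n p q {K K0 P minP hP minE P0 pq0} hp hq => [|n] p q [_]; last by exists ord0.
  by rewrite big_ord0 => /esym/eqP; rewrite oner_eq0.
pose g i j := ln (P i j) - ln (K i j).
(* Moving mass around the rectangle {i, i0} x {j, i0} keeps the marginals, so
   the mixed second differences of [g] vanish. *)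
have gE i j : g i j = g i i0 + g i0 j - g i0 i0.
  pose e (k : 'I_n) : 'I_n -> R := fun l => (l == k)%:R.
  pose D (ij : 'I_n * 'I_n) := (e i ij.1 - e i0 ij.1) * (e j ij.2 - e i0 ij.2).
  have e1 k : \sum_l e k l = 1 by rewrite (bigD1 k) //= big1 ?addr0 /e ?eqxx // => l /negPf ->.
  have sume k (F : 'I_n -> R) : \sum_l e k l * F l = F k.
    rewrite (bigD1 k) //= big1 ?addr0 /e ?eqxx ?mul1r // => l /negPf ->.
    by rewrite mul0r.
  have eB k l : \sum_m (e k m - e l m) = 0 by rewrite sumrB !e1 subrr.
  have sumeB k l (F : 'I_n -> R) : \sum_m (e k m - e l m) * F m = F k - F l.
    by under eq_bigr do rewrite mulrBl; rewrite sumrB !sume.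
  have := @minimizer_stationary R _ (entries (log_mx K)) (entries P) D.
  have -> : \sum_ij D ij * (ln (entries P ij) - entries (log_mx K) ij)
      = (g i j - g i i0) - (g i0 j - g i0 i0).
    transitivity (\sum_k (e i k - e i0 k) * \sum_l (e j l - e i0 l) * g k l).
      under [RHS]eq_bigr do rewrite mulr_sumr.
      rewrite pair_bigA; apply: eq_bigr => -[k l] _.
      by rewrite /D /entries /g mxE /= mulrA.
    by rewrite sumeB !sumeB.
  move=> st; suff : (g i j - g i i0) - (g i0 j - g i0 i0) = 0 by lra.
  apply: st => [ij||s Ms]; first exact: P0.
    rewrite -(pair_bigA _ (fun k l => (e i k - e i0 k) * (e j l - e i0 l))) /=.
    by rewrite big1 // => k _; rewrite -mulr_sumr eB mulr0.
  apply: minE; exists (\matrix_(k, l) (P k l + s * D (k, l))); last first.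
    by apply/funext => -[k l]; rewrite /entries mxE.
  have /transport_polytopeE [_ Pp Pq] := hP.
  apply/transport_polytopeE; split=> [k l|k|l]; first by rewrite mxE; exact: (Ms (k, l)).
    under eq_bigr do rewrite mxE.
    by rewrite big_split /= Pp -mulr_sumr /D /= -mulr_sumr eB !mulr0 addr0.
  under eq_bigr do rewrite mxE.
  by rewrite big_split /= Pq -mulr_sumr /D /= -mulr_suml eB mul0r mulr0 addr0.
(* By [gE] the log-ratio [g] splits into a row and a column part; the constant [g i0 i0] is assigned
   to the column factor. *)
pose d1 i := expR (g i i0).
pose d2 j := expR (g i0 j - g i0 i0).
apply/positive_scalingE; exists d1, d2; split=> [i|j|i j]; rewrite ?expR_gt0 //.
apply: ln_inj; rewrite ?posrE ?mulr_gt0 ?expR_gt0 //.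
rewrite !lnM ?posrE ?mulr_gt0 ?expR_gt0 // !expRK.
by have := gE i j; rewrite /g; lra.
Qed.

(* `|A| on matrices is the library's entrywise maximum norm mx_norm. *)
Theorem proposition2 (R : realType) (n : nat) (p q : 'cV[R]_n)
    (K K' : 'M[R]_n) (hp : simplex p) (hq : simplex q)
    (hK : forall i j, 0 < K i j) (hK' : forall i j, 0 < K' i j) :
  mx_norm1 (sinkhorn p q K - sinkhorn p q K') <= `|log_mx K - log_mx K'|.
Proof.
(* Nonemptiness ensures that [xget] returns an element of the set and not its default 0. *)
have mem (L : 'M[R]_n) (hL : forall i j, 0 < L i j) : sinkhorn_set p q L (sinkhorn p q L).
  have [P hP] := sinkhorn_set_nonempty hp hq hL.
  by apply: xgetPex; exists P.
have sub L P : sinkhorn_set p q L P -> transport_polytope p q P.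
  by rewrite /sinkhorn_set; case: ifP => _ [].
have S := mem K hK; have S' := mem K' hK'.
have := @energy_gaps_le _ _ (entries (log_mx K)) (entries (log_mx K'))
  (entries (sinkhorn p q K)) (entries (sinkhorn p q K'))
  `|log_mx K - log_mx K'| (normr_ge0 _).
rewrite /mx_norm1 pair_bigA /=.
under [X in _ -> X <= _]eq_bigr do rewrite !mxE.
apply.
- move=> ij; rewrite [leRHS]/Num.Def.normr /= mx_normrE.
  apply: le_trans (le_bigmax _ _ ij) => /=.
  by rewrite /entries !mxE.
- exact: sinkhorn_set_energy_gap S (sub _ _ S').
- exact: sinkhorn_set_energy_gap S' (sub _ _ S).
Qed.
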